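(* Let $m$ and $d$ be positive integers with $m\ge2$. There exist a positive integer $N=N(m,d)$ and a block $B=(b_1,\ldots,b_N)\in\{0,1\}^N$ such that for any real polynomial $P$ of degree $d$ and any real function $\eta\in\mathcal C^{d+1}([1,N])$ satisfying \[|\eta(t)|\le 1/20\quad\text{and}\quad \eta^{(d+1)}(t)\ne0\qquad\text{for all }t\in[1,N],\] there exists $n\in[1,N]$ such that \[\lfloor P(n)+\eta(n)\rfloor\not\equiv b_n\pmod m.\] *)

(* Defs.v *)
From Stdlib Require Import Reals ZArith Znumtheory.
From Coquelicot Require Import Coquelicot.
Open Scope R_scope.

(* Real polynomial with coefficient function c, of degree at most d:
   x |-> sum_{i=0}^d c_i x^i.  It has degree exactly d iff c d <> 0. *)
Definition poly_eval (c : nat -> R) (d : nat) (x : R) : R :=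
  sum_f_R0 (fun i => c i * x ^ i) d.

Definition continuous_within_interval (a b : R) (f : R -> R) (x : R) : Prop :=
  filterlim f (within (fun y => a <= y <= b) (locally x)) (locally (f x)).

Definition is_derive_on_interval (a b : R) (f f' : R -> R) : Prop :=
  forall x, a <= x <= b ->
    filterlim (fun h => (f (x + h) - f x) / h)
      (within (fun h => h <> 0 /\ a <= x + h <= b) (locally 0))
      (locally (f' x)).

(* D is a family of successive derivatives witnessing that D 0 = f is of class
   C^k on [a,b]: D (i+1) is the derivative of D i on [a,b] for i < k, and
   D 0, ..., D k are continuous on [a,b].  D k is then f^(k). *)
Definition Ck_derivs_on (a b : R) (k : nat) (f : R -> R) (D : nat -> R -> R) : Prop :=
  (forall x, D 0%nat x = f x) /\
  (forall i, (i < k)%nat -> is_derive_on_interval a b (D i) (D (S i))) /\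
  (forall i, (i <= k)%nat -> forall x, a <= x <= b -> continuous_within_interval a b (D i) x).

Definition floorR (x : R) : Z := Int_part x.

(* Main.v *)
(** Take [b n] to be the parity of [log2 n], so that [b (2 n)] always differs
    from [b n].  By polynomial recurrence there is [q], bounded in terms of [m]
    and [d], such that [q^j c_j] is very close to [m Z] for all [1 <= j <= d].
    Hence, on the multiples [q n] with [n] bounded, [P + eta] equals a fixed
    integer plus a multiple of [m] plus [h = eta + R], where [R] is a polynomial
    of degree at most [d] and [|h| < 1].  If the floors matched [b], then [h]
    would change sign on each of the [d + 2] disjoint intervals
    [[q 4^i, 2 q 4^i]], and Rolle's theorem would give a zero of
    [h^(d+1) = eta^(d+1)]. *)

Require Import Defs.
From Stdlib Require Import Reals ZArith Znumtheory Lra Lia List Classical.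
From Stdlib Require Import Ranalysis5.
From Coquelicot Require Import Coquelicot.
Open Scope R_scope.

(** * Distance to the integers *)

Definition near_Z (eps x : R) : Prop := exists z : Z, Rabs (x - IZR z) <= eps.

Lemma near_Z_weaken e e' x : e <= e' -> near_Z e x -> near_Z e' x.
Proof. intros H [z Hz]; exists z; lra. Qed.

Lemma near_Z_0 e : 0 <= e -> near_Z e 0.
Proof. intros H; exists 0%Z; rewrite Rminus_0_r, Rabs_R0; exact H. Qed.

Lemma near_Z_plus e e' x y : near_Z e x -> near_Z e' y -> near_Z (e + e') (x + y).
Proof.
  intros [z Hz] [w Hw]; exists (z + w)%Z; rewrite plus_IZR.
  replace (x + y - (IZR z + IZR w)) with ((x - IZR z) + (y - IZR w)) by ring.
  eapply Rle_trans; [apply Rabs_triang | lra].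
Qed.

Lemma near_Z_scal k e x : near_Z e x -> near_Z (INR k * e) (INR k * x).
Proof.
  intros [z Hz]; exists (Z.of_nat k * z)%Z.
  rewrite mult_IZR, <- INR_IZR_INZ.
  replace (INR k * x - INR k * IZR z) with (INR k * (x - IZR z)) by ring.
  rewrite Rabs_mult, (Rabs_pos_eq (INR k)) by apply pos_INR.
  apply Rmult_le_compat_l; [apply pos_INR | exact Hz].
Qed.

(** * Pigeonhole principle on the torus *)

Lemma pigeonhole (r : nat) (f : nat -> nat) :
  (forall i, (i <= r)%nat -> (f i < r)%nat) ->
  exists u v, (u < v <= r)%nat /\ f u = f v.
Proof.
  intros Hf; apply NNPP; intros Hn.
  assert (Hnd : NoDup (map f (seq 0 (S r)))).
  { apply NoDup_map_NoDup_ForallPairs; [|apply seq_NoDup].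
    intros x y Hx Hy Hxy; apply in_seq in Hx, Hy.
    destruct (Nat.lt_trichotomy x y) as [H|[H|H]]; [|exact H|];
      exfalso; apply Hn; [exists x, y | exists y, x]; (split; [lia | now auto]). }
  assert (Hi : incl (map f (seq 0 (S r))) (seq 0 r)).
  { intros y Hy; apply in_map_iff in Hy; destruct Hy as [x [<- Hx]].
    apply in_seq in Hx; apply in_seq; specialize (Hf x); lia. }
  pose proof (NoDup_incl_length Hnd Hi) as H.
  rewrite length_map, !length_seq in H; lia.
Qed.

(** Index of the arc [[k/M, (k+1)/M)] of the circle R/Z that contains [x]. *)
Definition cell (M : nat) (x : R) : nat :=
  Z.to_nat (Int_part (INR M * x) mod Z.of_nat M).

Lemma cell_lt M x : (0 < M)%nat -> (cell M x < M)%nat.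
Proof.
  intros HM; unfold cell.
  pose proof (Z.mod_pos_bound (Int_part (INR M * x)) (Z.of_nat M)); lia.
Qed.

(** The floors of [M * x] and [M * y] differ by a multiple [M * k], so [M * (y - x)] is within 1 of
    [M * k]. *)
Lemma cell_near M x y :
  (0 < M)%nat -> cell M x = cell M y -> near_Z (/ INR M) (y - x).
Proof.
  intros HM H; unfold cell in H.
  set (zx := Int_part (INR M * x)) in *; set (zy := Int_part (INR M * y)) in *.
  pose proof (Z.mod_pos_bound zx (Z.of_nat M)) as Bx.
  pose proof (Z.mod_pos_bound zy (Z.of_nat M)) as By.
  assert (Hz : (zx mod Z.of_nat M = zy mod Z.of_nat M)%Z) by lia.
  pose proof (Z.div_mod zx (Z.of_nat M)) as Dx.
  pose proof (Z.div_mod zy (Z.of_nat M)) as Dy.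
  set (k := (zy / Z.of_nat M - zx / Z.of_nat M)%Z).
  assert (Hk : (zy - zx = Z.of_nat M * k)%Z) by (unfold k; nia).
  exists k.
  apply (f_equal IZR) in Hk; rewrite minus_IZR, mult_IZR, <- INR_IZR_INZ in Hk.
  destruct (base_Int_part (INR M * x)) as [X1 X2].
  destruct (base_Int_part (INR M * y)) as [Y1 Y2].
  fold zx in X1, X2; fold zy in Y1, Y2.
  assert (HM' : 0 < INR M) by (apply lt_0_INR; lia).
  apply Rmult_le_reg_l with (INR M); [exact HM'|].
  rewrite Rinv_r by lra.
  rewrite <- (Rabs_pos_eq (INR M)) at 1 by lra.
  rewrite <- Rabs_mult; apply Rabs_le; split; nra.
Qed.

(** The cells of the first [s] coordinates are the digits of a number in base [M], so the boxes of
    the torus become pigeonholes numbered below [M ^ s]. *)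
Fixpoint cells_code (M : nat) (x : nat -> R) (s : nat) : nat :=
  match s with
  | O => O
  | S s' => M * cells_code M x s' + cell M (x s')
  end.

Lemma cells_code_lt M x s : (0 < M)%nat -> (cells_code M x s < M ^ s)%nat.
Proof.
  intros HM; induction s as [|s IH]; simpl; [lia|].
  pose proof (cell_lt M (x s) HM); nia.
Qed.

Lemma cells_code_inj M x y s :
  (0 < M)%nat -> cells_code M x s = cells_code M y s ->
  forall l, (l < s)%nat -> cell M (x l) = cell M (y l).
Proof.
  intros HM; induction s as [|s IH]; simpl; intros H l Hl; [lia|].
  apply Nat.div_mod_unique in H; try (apply cell_lt; exact HM).
  destruct H as [H1 H2].
  destruct (Nat.eq_dec l s) as [->|Hne]; [exact H2 | apply IH; [exact H1 | lia]].
Qed.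

Lemma torus_pigeonhole (s : nat) (eps : R) :
  0 < eps ->
  exists T : nat, forall y : nat -> nat -> R,
    exists u v, (u < v <= T)%nat /\
      forall l, (l < s)%nat -> near_Z eps (y v l - y u l).
Proof.
  intros Heps.
  destruct (archimed_cor1 eps Heps) as [M [HM1 HM2]].
  exists (M ^ s)%nat; intros y.
  destruct (pigeonhole (M ^ s) (fun i => cells_code M (y i) s)) as [u [v [Huv H]]].
  { intros i _; apply cells_code_lt; exact HM2. }
  exists u, v; split; [exact Huv|]; intros l Hl.
  apply near_Z_weaken with (/ INR M); [lra|].
  apply cell_near; [exact HM2|].
  exact (cells_code_inj M _ _ s HM2 H l Hl).
Qed.

(** * Polynomial recurrence *)

(** By the binomial theorem [(T+e)^j - T^j] is a combination of the [e^k], [1 <= k <= j], with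
    natural coefficients whose sum is its value at [e = 1]. The induction peels off one factor
    [T + e] and absorbs its [e] into [a], which is why [a] stays quantified. *)
Lemma pow_add_sub_near (T e : nat) (eps : R) (j : nat) : forall a : R,
  (forall k, (1 <= k <= j)%nat -> near_Z eps (INR e ^ k * a)) ->
  near_Z (((INR T + 1) ^ j - INR T ^ j) * eps)
         (((INR T + INR e) ^ j - INR T ^ j) * a).
Proof.
  induction j as [|j IH]; intros a Ha.
  - simpl; rewrite !Rminus_diag, !Rmult_0_l; apply near_Z_0; lra.
  - assert (H1 := near_Z_scal T _ _ (IH a (fun k Hk => Ha k ltac:(lia)))).
    assert (H2 := IH (INR e * a)).
    assert (H3 := near_Z_scal (T ^ j) _ _ (Ha 1%nat ltac:(lia))).
    assert (H2' : forall k, (1 <= k <= j)%nat -> near_Z eps (INR e ^ k * (INR e * a))).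
    { intros k Hk; replace (INR e ^ k * (INR e * a)) with (INR e ^ S k * a)
        by (simpl; ring).
      apply Ha; lia. }
    specialize (H2 H2'); rewrite pow_INR in H3.
    pose proof (near_Z_plus _ _ _ _ (near_Z_plus _ _ _ _ H1 H2) H3) as H.
    replace (((INR T + 1) ^ S j - INR T ^ S j) * eps) with
      (INR T * (((INR T + 1) ^ j - INR T ^ j) * eps) +
       ((INR T + 1) ^ j - INR T ^ j) * eps + INR T ^ j * eps) by (simpl; ring).
    replace (((INR T + INR e) ^ S j - INR T ^ S j) * a) with
      (INR T * (((INR T + INR e) ^ j - INR T ^ j) * a) +
       ((INR T + INR e) ^ j - INR T ^ j) * (INR e * a) +
       INR T ^ j * (INR e ^ 1 * a)) by (simpl; ring).
    exact H.
Qed.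

(** Once both extreme powers are removed, the expansion in degree [j+1] contains only [e^k] with
    [1 <= k <= j]; closeness in degrees up to [j] thus controls the cross terms of degree [j+1]. *)
Lemma pow_add_cross_near (T e : nat) (eps : R) (j : nat) : forall a : R,
  (forall k, (1 <= k <= j)%nat -> near_Z eps (INR e ^ k * a)) ->
  near_Z (((INR T + 1) ^ S j - INR T ^ S j - 1) * eps)
         (((INR T + INR e) ^ S j - INR T ^ S j - INR e ^ S j) * a).
Proof.
  induction j as [|j IH]; intros a Ha.
  - replace (((INR T + INR e) ^ 1 - INR T ^ 1 - INR e ^ 1) * a) with 0
      by (simpl; ring).
    replace (((INR T + 1) ^ 1 - INR T ^ 1 - 1) * eps) with 0 by (simpl; ring).
    apply near_Z_0; lra.
  - assert (H1 := near_Z_scal T _ _ (pow_add_sub_near T e eps (S j) a Ha)).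
    assert (H2 := IH (INR e * a)).
    assert (H3 := near_Z_scal (T ^ S j) _ _ (Ha 1%nat ltac:(lia))).
    assert (H2' : forall k, (1 <= k <= j)%nat -> near_Z eps (INR e ^ k * (INR e * a))).
    { intros k Hk; replace (INR e ^ k * (INR e * a)) with (INR e ^ S k * a)
        by (simpl; ring).
      apply Ha; lia. }
    specialize (H2 H2'); rewrite pow_INR in H3.
    pose proof (near_Z_plus _ _ _ _ (near_Z_plus _ _ _ _ H1 H2) H3) as H.
    match type of H with near_Z ?x ?y =>
      match goal with |- near_Z ?x' ?y' =>
        replace x' with x by (simpl; ring); replace y' with y by (simpl; ring)
      end end.
    exact H.
Qed.

(** [Q] comes before [a]: this uniformity is what lets the block be fixed before the polynomial is
    known. *)
Definition recurrent (s d : nat) : Prop :=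
  forall eps : R, 0 < eps -> exists Q : nat, forall a : nat -> R,
    exists q : nat, (1 <= q <= Q)%nat /\
      forall l j, (l < s)%nat -> (1 <= j <= d)%nat -> near_Z eps (INR q ^ j * a l).

(* Each new term of [p] adds an increment recurrent in degrees [<= d] to a
   precision chosen after the previous terms are bounded, so that cross terms
   are negligible and [q^(d+1)] is additive, up to the error, along [p]. *)
Lemma recurrent_chain (s d : nat) : recurrent s d ->
  forall (delta : R) (t : nat), 0 < delta -> exists Q : nat, forall a : nat -> R,
    exists (p : nat -> nat) (y : nat -> nat -> R),
      (forall u v, (u < v <= t)%nat -> (p u < p v)%nat) /\
      (forall u, (u <= t)%nat -> (p u <= Q)%nat) /\
      forall u v l, (u <= v <= t)%nat -> (l < s)%nat ->
        (forall j, (1 <= j <= d)%nat ->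
           near_Z (INR v * delta) (INR (p v - p u) ^ j * a l)) /\
        near_Z (INR v * delta) (INR (p v - p u) ^ S d * a l - (y v l - y u l)).
Proof.
  intros Hrec delta t Hdelta; induction t as [|t [Q IH]].
  - exists 0%nat; intros a; exists (fun _ => 0%nat), (fun _ _ => 0).
    split; [intros; lia|]; split; [intros; lia|].
    intros u v l Huv Hl; replace v with 0%nat by lia; simpl INR.
    split; [intros j Hj|]; rewrite pow_i by lia.
    + rewrite !Rmult_0_l; apply near_Z_0; lra.
    + rewrite Rminus_diag, Rminus_0_r, !Rmult_0_l; apply near_Z_0; lra.
  - assert (HQ : 1 <= INR Q + 1) by (pose proof (pos_INR Q); lra).
    assert (HB : 0 < (INR Q + 1) ^ S d) by (apply pow_lt; lra).
    (* [Q] bounds all previous gaps, so the coefficients of the cross terms sum to at most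
       [(Q+1)^(d+1)], and one more increment costs at most [delta]. *)
    set (eps := delta / (INR Q + 1) ^ S d).
    assert (Heps : 0 < eps) by (apply Rdiv_lt_0_compat; lra).
    assert (Hde : (INR Q + 1) ^ S d * eps = delta) by (unfold eps; field; lra).
    destruct (Hrec eps Heps) as [Qe He].
    exists (Q + Qe)%nat; intros a.
    destruct (IH a) as [p [y [Hp [HpQ Hy]]]].
    destruct (He a) as [e [Hebd Hea]].
    exists (fun i => if (i <=? t)%nat then p i else (p t + e)%nat).
    (* [y] accumulates [e^(d+1) * a l] over the increments [e], so that for a gap [q] of the chain
       [q^(d+1) * a l] is close, modulo 1, to a difference of two values of [y]. *)
    exists (fun i l => if (i <=? t)%nat then y i l else y t l + INR e ^ S d * a l).
    assert (Hle : forall i, (i <= t)%nat -> (i <=? t)%nat = true)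
      by (intros; apply Nat.leb_le; lia).
    assert (Hgt : (S t <=? t)%nat = false) by (apply Nat.leb_gt; lia).
    assert (Hpt : forall u, (u <= t)%nat -> (p u <= p t)%nat).
    { intros u Hu; destruct (Nat.eq_dec u t) as [->|Hne]; [lia|].
      apply Nat.lt_le_incl, Hp; lia. }
    split; [|split].
    + intros u v Huv; rewrite (Hle u) by lia.
      destruct (Nat.eq_dec v (S t)) as [->|Hne].
      * rewrite Hgt; specialize (Hpt u); lia.
      * rewrite Hle by lia; apply Hp; lia.
    + intros u Hu; destruct (Nat.eq_dec u (S t)) as [->|Hne].
      * rewrite Hgt; specialize (HpQ t); lia.
      * rewrite Hle by lia; specialize (HpQ u); lia.
    + intros u v l Huv Hl.
      destruct (Nat.eq_dec v (S t)) as [->|Hne];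
        [|rewrite !Hle by lia; apply Hy; lia].
      rewrite Hgt.
      destruct (Nat.eq_dec u (S t)) as [->|Hneu].
      * rewrite Hgt, Nat.sub_diag; simpl (INR 0).
        assert (0 <= INR (S t) * delta)
          by (apply Rmult_le_pos; [apply pos_INR | lra]).
        split; [intros j Hj|]; rewrite pow_i by lia.
        -- rewrite Rmult_0_l; apply near_Z_0; lra.
        -- rewrite Rminus_diag, Rminus_0_r, Rmult_0_l; apply near_Z_0; lra.
      * rewrite (Hle u) by lia.
        specialize (Hpt u ltac:(lia)).
        replace (p t + e - p u)%nat with ((p t - p u) + e)%nat by lia.
        destruct (Hy u t l ltac:(lia) Hl) as [Hy1 Hy2].
        assert (HT : INR (p t - p u) <= INR Q)
          by (apply le_INR; specialize (HpQ t); lia).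
        set (T := (p t - p u)%nat) in *.
        pose proof (pos_INR T) as HT0.
        assert (Hbd : forall j, (j <= S d)%nat -> (INR T + 1) ^ j * eps <= delta).
        { intros j Hj; rewrite <- Hde; apply Rmult_le_compat_r; [lra|].
          apply Rle_trans with ((INR Q + 1) ^ j);
            [apply pow_incr; lra | apply Rle_pow; [lra | exact Hj]]. }
        rewrite plus_INR, S_INR, Rmult_plus_distr_r, Rmult_1_l.
        split; [intros j Hj|].
        -- replace ((INR T + INR e) ^ j * a l) with
             (INR T ^ j * a l + ((INR T + INR e) ^ j - INR T ^ j) * a l) by ring.
           apply near_Z_plus; [apply Hy1; exact Hj|].
           apply near_Z_weaken with (((INR T + 1) ^ j - INR T ^ j) * eps).
           { specialize (Hbd j ltac:(lia)).
             pose proof (pow_le (INR T) j HT0); nra. }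
           apply pow_add_sub_near; intros k Hk; apply Hea; [exact Hl | lia].
        -- replace ((INR T + INR e) ^ S d * a l -
                    (y t l + INR e ^ S d * a l - y u l)) with
             ((INR T ^ S d * a l - (y t l - y u l)) +
              ((INR T + INR e) ^ S d - INR T ^ S d - INR e ^ S d) * a l) by ring.
           apply near_Z_plus; [exact Hy2|].
           apply near_Z_weaken with
             (((INR T + 1) ^ S d - INR T ^ S d - 1) * eps).
           { specialize (Hbd (S d) ltac:(lia)).
             pose proof (pow_le (INR T) (S d) HT0); nra. }
           apply pow_add_cross_near; intros k Hk; apply Hea; [exact Hl | lia].
Qed.

(** Induction on the degree. The pigeonhole principle, applied to the points [y] of a chain, finds
    two that nearly agree modulo 1. The gap [p v - p u] is then good in degree [d+1], and the chain
    makes it good in the lower degrees. *)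
Theorem polynomial_recurrence (s d : nat) : recurrent s d.
Proof.
  induction d as [|d IH]; intros eps Heps.
  - exists 1%nat; intros a; exists 1%nat; split; [lia | intros; lia].
  - destruct (torus_pigeonhole s (eps / 2) ltac:(lra)) as [T HT].
    pose proof (pos_INR T) as HT0.
    (* At most [T] increments, each losing this much, cost at most [eps / 2]; the other half is left
       for the pigeonhole principle. *)
    assert (Hdelta : 0 < eps / 2 / (INR T + 1)) by (apply Rdiv_lt_0_compat; lra).
    destruct (recurrent_chain s d IH _ T Hdelta) as [Q HQ].
    exists Q; intros a.
    destruct (HQ a) as [p [y [Hp [HpQ Hy]]]].
    destruct (HT y) as [u [v [Huv Hn]]].
    exists (p v - p u)%nat.
    split; [specialize (Hp u v); specialize (HpQ v); lia|].
    intros l j Hl Hj.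
    destruct (Hy u v l ltac:(lia) Hl) as [Hy1 Hy2].
    assert (Hv : INR v * (eps / 2 / (INR T + 1)) <= eps / 2).
    { assert (INR v <= INR T) by (apply le_INR; lia).
      apply Rle_trans with ((INR T + 1) * (eps / 2 / (INR T + 1)));
        [apply Rmult_le_compat_r; lra | right; field; lra]. }
    destruct (Nat.eq_dec j (S d)) as [->|Hne].
    + replace (INR (p v - p u) ^ S d * a l) with
        ((INR (p v - p u) ^ S d * a l - (y v l - y u l)) + (y v l - y u l)) by ring.
      replace eps with (eps / 2 + eps / 2) by field.
      apply near_Z_plus; [|apply Hn; exact Hl].
      exact (near_Z_weaken _ _ _ Hv Hy2).
    + apply near_Z_weaken with (eps / 2); [lra|].
      apply (near_Z_weaken _ _ _ Hv); apply Hy1; lia.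
Qed.

(** * Iterated Rolle theorem *)

Lemma finite_choice {A : Type} (inh : A) (P : nat -> A -> Prop) (k : nat) :
  (forall i, (i < k)%nat -> exists y, P i y) ->
  exists f, forall i, (i < k)%nat -> P i (f i).
Proof.
  induction k as [|k IH]; intros H.
  - exists (fun _ => inh); intros; lia.
  - destruct IH as [f Hf]; [intros; apply H; lia|].
    destruct (H k ltac:(lia)) as [y Hy].
    exists (fun i => if (i =? k)%nat then y else f i); intros i Hi.
    destruct (Nat.eqb_spec i k) as [->|Hne]; [exact Hy | apply Hf; lia].
Qed.

Lemma rolle_is_derive (f f' : R -> R) (x y : R) :
  x < y -> f x = 0 -> f y = 0 ->
  (forall t, x <= t <= y -> is_derive f t (f' t)) ->
  exists t, x < t < y /\ f' t = 0.
Proof.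
  intros Hxy Hx Hy Hd.
  assert (Hpr : forall t, x <= t <= y -> derivable_pt f t).
  { intros t Ht; exists (f' t); apply is_derive_Reals, Hd; exact Ht. }
  destruct (Rolle f x y (fun t Ht => Hpr t ltac:(lra))) as [t [Ht H]].
  - intros t Ht; apply derivable_continuous_pt, Hpr; exact Ht.
  - exact Hxy.
  - lra.
  - exists t; split; [exact Ht|].
    rewrite Derive_Reals in H; rewrite <- H; symmetry.
    apply is_derive_unique, Hd; lra.
Qed.

(** Rolle between consecutive zeros of [F 0] gives interlaced, hence increasing, zeros of [F 1]; the
    induction then applies to the shifted family. *)
Lemma iterated_rolle (a b : R) (k : nat) : forall (F : nat -> R -> R) (x : nat -> R),
  (forall i t, (i < k)%nat -> a < t < b -> is_derive (F i) t (F (S i) t)) ->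
  (forall i, (i <= k)%nat -> a < x i < b /\ F 0%nat (x i) = 0) ->
  (forall i, (i < k)%nat -> x i < x (S i)) ->
  exists t, a < t < b /\ F k t = 0.
Proof.
  induction k as [|k IH]; intros F x HF Hx Hinc.
  - exists (x 0%nat); apply Hx; lia.
  - destruct (finite_choice 0 (fun i t => x i < t < x (S i) /\ F 1%nat t = 0) (S k))
      as [z Hz].
    { intros i Hi.
      destruct (Hx i ltac:(lia)) as [Hxi Hi0].
      destruct (Hx (S i) ltac:(lia)) as [Hxs Hs0].
      apply rolle_is_derive with (F 0%nat); auto.
      intros t Ht; apply HF; [lia | lra]. }
    apply (IH (fun i => F (S i)) z).
    + intros i t Hi; apply HF; lia.
    + intros i Hi; destruct (Hz i ltac:(lia)) as [Hzi Hzi0].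
      destruct (Hx i ltac:(lia)) as [Hxi _].
      destruct (Hx (S i) ltac:(lia)) as [Hxs _].
      split; [lra | exact Hzi0].
    + intros i Hi.
      destruct (Hz i ltac:(lia)) as [Hzi _].
      destruct (Hz (S i) ltac:(lia)) as [Hzs _]; lra.
Qed.

(** The equivalence expresses a change of sign as the floor sees it, with 0 counted as nonnegative;
    hence the root may fall on an endpoint. *)
Lemma root_of_sign_change (f : R -> R) (x y : R) :
  x < y -> (forall t, x <= t <= y -> continuity_pt f t) ->
  (0 <= f x <-> f y < 0) ->
  exists t, x <= t <= y /\ f t = 0.
Proof.
  intros Hxy Hc Hs.
  destruct (Rtotal_order (f x) 0) as [Hx|[Hx|Hx]].
  - assert (Hy : 0 <= f y) by (apply Rnot_lt_le; intros H; apply Hs in H; lra).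
    destruct Hy as [Hy|Hy].
    + destruct (IVT_interv f x y Hc Hxy Hx Hy) as [t Ht]; exists t; exact Ht.
    + exists y; lra.
  - exists x; lra.
  - assert (Hy : f y < 0) by (apply Hs; lra).
    destruct (IVT_interv (fun t => - f t) x y) as [t [Ht Ht0]]; try lra.
    + intros t Ht; apply continuity_pt_opp, Hc; exact Ht.
    + exists t; split; [exact Ht | lra].
Qed.

(** * Derivatives *)

Lemma is_derive_of_is_derive_on_interval (a b : R) (f f' : R -> R) (x : R) :
  is_derive_on_interval a b f f' -> a < x < b -> is_derive f x (f' x).
Proof.
  intros H Hx; apply is_derive_Reals; intros eps Heps.
  assert (Hx' : a <= x <= b) by lra.
  destruct (proj1 (filterlim_locally _ _) (H x Hx') (mkposreal eps Heps))
    as [del Hdel].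
  assert (Hm : 0 < Rmin del (Rmin (x - a) (b - x))).
  { repeat apply Rmin_pos; [apply cond_pos | lra | lra]. }
  exists (mkposreal _ Hm); intros h Hh Hhd; simpl in Hhd.
  pose proof (Rmin_l del (Rmin (x - a) (b - x))).
  pose proof (Rmin_r del (Rmin (x - a) (b - x))).
  pose proof (Rmin_l (x - a) (b - x)).
  pose proof (Rmin_r (x - a) (b - x)).
  assert (Hab : Rabs h < x - a /\ Rabs h < b - x) by lra.
  apply (Hdel h).
  - change (Rabs (h - 0) < del); rewrite Rminus_0_r; lra.
  - split; [exact Hh|].
    destruct Hab as [Ha Hb]; apply Rabs_def2 in Ha, Hb; lra.
Qed.

Definition deriv_coef (c : nat -> R) (i : nat) : R := INR (S i) * c (S i).

(** The vanishing of [c (S d)] makes the top coefficient of the derivative 0, so differentiation can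
    be iterated with [d] fixed. *)
Lemma is_derive_poly_eval (c : nat -> R) (d : nat) (x : R) :
  c (S d) = 0 -> is_derive (poly_eval c d) x (poly_eval (deriv_coef c) d x).
Proof.
  intros Hc.
  assert (H : forall n, is_derive (poly_eval c (S n)) x (poly_eval (deriv_coef c) n x)).
  { induction n as [|n IH].
    - unfold poly_eval, deriv_coef; simpl; auto_derive; [exact I | ring].
    - apply (is_derive_plus (poly_eval c (S n)) (fun t => c (S (S n)) * t ^ S (S n)));
        [exact IH|].
      unfold deriv_coef; auto_derive; [exact I | simpl; ring]. }
  apply is_derive_ext with (poly_eval c (S d)); [|apply H].
  intros t; change (poly_eval c d t + c (S d) * t ^ S d = poly_eval c d t :> R).
  rewrite Hc; ring.
Qed.

Lemma iter_deriv_coef_0 (c : nat -> R) (d i : nat) :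
  (forall j, (d < j)%nat -> c j = 0) ->
  forall j, (d < j + i)%nat -> Nat.iter i deriv_coef c j = 0.
Proof.
  intros Hc; induction i as [|i IH]; intros j Hj; simpl.
  - apply Hc; lia.
  - unfold deriv_coef at 1; rewrite IH by lia; ring.
Qed.

Lemma poly_eval_0 (c : nat -> R) (d : nat) (x : R) :
  (forall j, c j = 0) -> poly_eval c d x = 0.
Proof.
  intros H; unfold poly_eval; induction d as [|d IH]; simpl; rewrite H; [ring|].
  rewrite IH; ring.
Qed.

(** * Reduction modulo [m] and the theorem *)

Lemma floorR_shift (z : Z) (x : R) :
  -1 <= x < 1 ->
  floorR (IZR z + x) = if Rle_dec 0 x then z else (z - 1)%Z.
Proof.
  intros Hx; unfold floorR; symmetry.
  destruct (Rle_dec 0 x); apply Int_part_spec;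
    rewrite ?minus_IZR; split; lra.
Qed.

(** Coefficients of the remainder R. The part [m * z j / q^j] removed from [c j] contributes
    [m * z j * n^j] at [q * n], a multiple of [m]; the constant term loses only the integer [k0].
    Zeros beyond [d] make the derivatives of order above [d] vanish. *)
Definition reduced_coef (c : nat -> R) (d m q : nat) (k0 : Z) (z : nat -> Z)
    (j : nat) : R :=
  match j with
  | O => c O - IZR k0
  | S _ => if (j <=? d)%nat then c j - INR m * IZR (z j) / INR q ^ j else 0
  end.

(** The constant term accounts for 1/2. The term of degree [j >= 1] equals
    [m * (q^j * c j / m - z j) * n^j] at [q * n], hence is at most [m * eps * K^d] in absolute
    value. *)
Lemma reduced_poly (c : nat -> R) (d m q n K : nat) (k0 : Z) (z : nat -> Z) (eps : R) :
  (1 <= q)%nat -> (1 <= n <= K)%nat -> (1 <= m)%nat ->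
  Rabs (c O - IZR k0) <= 1 / 2 ->
  (forall j, (1 <= j <= d)%nat -> Rabs (INR q ^ j * (c j / INR m) - IZR (z j)) <= eps) ->
  let r := reduced_coef c d m q k0 z in
  exists Z0 : Z,
    poly_eval c d (INR (q * n)) =
      IZR (Z.of_nat m * Z0 + k0) + poly_eval r d (INR (q * n)) /\
    Rabs (poly_eval r d (INR (q * n))) <= 1 / 2 + INR d * (INR m * eps * INR K ^ d).
Proof.
  intros Hq Hn Hm Hc0 Hz r.
  assert (Hq' : 0 < INR q) by (apply lt_0_INR; lia).
  assert (Hm' : 0 < INR m) by (apply lt_0_INR; lia).
  assert (Hn' : 0 <= INR n <= INR K) by (split; [apply pos_INR | apply le_INR; lia]).
  assert (HK : 1 <= INR K) by (apply (le_INR 1); lia).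
  assert (H : forall i, (i <= d)%nat -> exists Z0 : Z,
    poly_eval c i (INR (q * n)) =
      IZR (Z.of_nat m * Z0 + k0) + poly_eval r i (INR (q * n)) /\
    Rabs (poly_eval r i (INR (q * n))) <= 1 / 2 + INR i * (INR m * eps * INR K ^ d)).
  2: { apply H; lia. }
  induction i as [|i IH]; intros Hi.
  - exists 0%Z; rewrite Z.mul_0_r; unfold poly_eval, r; simpl.
    split; [ring|]; rewrite Rmult_1_r; lra.
  - destruct (IH ltac:(lia)) as [Z0 [E B]].
    exists (Z0 + z (S i) * Z.of_nat n ^ Z.of_nat (S i))%Z.
    assert (Hr : r (S i) = c (S i) - INR m * IZR (z (S i)) / INR q ^ S i).
    { unfold r, reduced_coef; replace (S i <=? d)%nat with true; [reflexivity|].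
      symmetry; apply Nat.leb_le; exact Hi. }
    assert (Hqi : INR q ^ S i <> 0) by (apply pow_nonzero; lra).
    assert (Hstep : forall f, poly_eval f (S i) (INR (q * n)) =
              poly_eval f i (INR (q * n)) + f (S i) * (INR q ^ S i * INR n ^ S i)).
    { intros f; unfold poly_eval; rewrite tech5, mult_INR, Rpow_mult_distr; ring. }
    assert (Hterm : r (S i) * (INR q ^ S i * INR n ^ S i) =
      INR m * (INR q ^ S i * (c (S i) / INR m) - IZR (z (S i))) * INR n ^ S i).
    { rewrite Hr; field; split; [lra | exact Hqi]. }
    rewrite !Hstep; split.
    + rewrite E, Hr, !plus_IZR, !mult_IZR, plus_IZR, mult_IZR, <- pow_IZR,
        <- !INR_IZR_INZ.
      field; exact Hqi.
    + rewrite Hterm; eapply Rle_trans; [apply Rabs_triang|].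
      rewrite S_INR.
      assert (Ht : Rabs (INR m * (INR q ^ S i * (c (S i) / INR m) - IZR (z (S i)))
                 * INR n ^ S i) <= INR m * eps * INR K ^ d).
      { specialize (Hz (S i) ltac:(lia)).
        rewrite !Rabs_mult, (Rabs_pos_eq (INR m)) by lra.
        rewrite (Rabs_pos_eq (INR n ^ S i)) by (apply pow_le; lra).
        apply Rmult_le_compat.
        - apply Rmult_le_pos; [lra | apply Rabs_pos].
        - apply pow_le; lra.
        - apply Rmult_le_compat_l; lra.
        - apply Rle_trans with (INR K ^ S i);
            [apply pow_incr; lra | apply Rle_pow; [lra | exact Hi]]. }
      lra.
Qed.

Theorem theorem7 (m d : nat) (hm : (2 <= m)%nat) (hd : (1 <= d)%nat) :
  exists (N : nat) (b : nat -> bool), (1 <= N)%nat /\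
    forall (c : nat -> R) (eta : R -> R) (D : nat -> R -> R),
      c d <> 0 ->
      Ck_derivs_on 1 (INR N) (S d) eta D ->
      (forall t, 1 <= t <= INR N -> Rabs (eta t) <= 1 / 20 /\ D (S d) t <> 0) ->
      exists n : nat, (1 <= n <= N)%nat /\
        ~ (Z.of_nat m | floorR (poly_eval c d (INR n) + eta (INR n)) - Z.b2z (b n))%Z.
Proof.
  (* Right end, divided by [q], of the last of the [d+2] intervals. Exponents start at 1, which
     keeps all the intervals to the right of 1. *)
  set (K := (2 * 4 ^ (d + 2))%nat).
  assert (HK4 : forall i, (i <= S d)%nat -> (4 <= 4 ^ S i /\ 2 * 4 ^ S i <= K)%nat).
  { intros i Hi; split.
    - change 4%nat with (4 ^ 1)%nat at 1; apply Nat.pow_le_mono_r; lia.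
    - unfold K; apply Nat.mul_le_mono_l, Nat.pow_le_mono_r; lia. }
  assert (HK1 : 0 < INR K) by (apply lt_0_INR; specialize (HK4 0%nat); lia).
  assert (Hm0 : 0 < INR m) by (apply lt_0_INR; lia).
  assert (HKd : 0 < INR K ^ d) by (apply pow_lt; exact HK1).
  assert (Hd1 : 0 < INR (S d)) by (apply lt_0_INR; lia).
  (* Chosen so that the nonconstant terms of R contribute at most 1/20 in total. *)
  set (eps := 1 / 20 / (INR (S d) * INR m * INR K ^ d)).
  assert (Hden : 0 < INR (S d) * INR m * INR K ^ d)
    by (repeat apply Rmult_lt_0_compat; assumption).
  assert (Heps : 0 < eps) by (apply Rdiv_lt_0_compat; lra).
  assert (Hsmall : INR d * (INR m * eps * INR K ^ d) <= 1 / 20).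
  { replace (1 / 20) with (INR (S d) * (INR m * eps * INR K ^ d)).
    - apply Rmult_le_compat_r; [|apply le_INR; lia].
      apply Rmult_le_pos; [apply Rmult_le_pos|]; lra.
    - unfold eps; field; repeat split; lra. }
  destruct (polynomial_recurrence (S d) d eps Heps) as [Q HQ].
  (* The extra 1 keeps every [q * n] with [q <= Q] and [n <= K] strictly below [N], where the
     derivatives are two-sided. *)
  exists (Q * K + 1)%nat, (fun n => Nat.odd (Nat.log2 n)).
  split; [lia|].
  set (N := (Q * K + 1)%nat).
  intros c eta D _ [HD0 [HD1 _]] Heta.
  destruct (HQ (fun l => c l / INR m)) as [q [Hq Hnear]].
  apply NNPP; intros Hno.
  assert (Hall : forall n, (1 <= n <= N)%nat ->
    (Z.of_nat m | floorR (poly_eval c d (INR n) + eta (INR n))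
                  - Z.b2z (Nat.odd (Nat.log2 n)))%Z).
  { intros n Hn; apply NNPP; intros H; apply Hno; exists n; auto. }
  destruct (finite_choice 0%Z
    (fun j z => (1 <= j)%nat -> Rabs (INR q ^ j * (c j / INR m) - IZR z) <= eps) (S d))
    as [z Hz].
  { intros j Hj; destruct (Nat.eq_dec j 0) as [->|Hne].
    - exists 0%Z; lia.
    - destruct (Hnear j j Hj ltac:(lia)) as [w Hw]; exists w; intros _; exact Hw. }
  (* The constant term is not scaled by [q]; it is only brought within 1/2 of an integer. *)
  set (k0 := Int_part (c 0%nat + 1 / 2)).
  assert (Hk0 : Rabs (c 0%nat - IZR k0) <= 1 / 2).
  { destruct (base_Int_part (c 0%nat + 1 / 2)) as [H1 H2]; fold k0 in H1, H2.
    apply Rabs_le; lra. }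
  set (r := reduced_coef c d m q k0 z).
  assert (Hr0 : forall j, (d < j)%nat -> r j = 0).
  { intros j Hj; unfold r, reduced_coef; destruct j as [|j]; [lia|].
    replace (S j <=? d)%nat with false; [reflexivity|].
    symmetry; apply Nat.leb_gt; exact Hj. }
  (* [F 0] is [h = eta + R], and [F (S d)] is the derivative of [eta] of order [d+1], since [d+1]
     differentiations kill R. *)
  set (F := fun i t => D i t + poly_eval (Nat.iter i deriv_coef r) d t).
  assert (HF : forall i t, (i < S d)%nat -> 1 < t < INR N ->
                 is_derive (F i) t (F (S i) t)).
  { intros i t Hi Ht; apply (is_derive_plus (D i)).
    - apply is_derive_of_is_derive_on_interval with 1 (INR N); [apply HD1|]; assumption.
    - apply is_derive_poly_eval, (iter_deriv_coef_0 _ d); [exact Hr0 | lia]. }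
  (* Since [|h| <= 1/2 + 1/20 + 1/20 < 1] at these points, the floor modulo [m] is [k0] or [k0 - 1]
     according to the sign of [h]. *)
  assert (Hfloor : forall n, (1 <= n <= K)%nat -> exists Z0 : Z,
    floorR (poly_eval c d (INR (q * n)) + eta (INR (q * n))) =
    (Z.of_nat m * Z0 + k0 + if Rle_dec 0 (F 0%nat (INR (q * n))) then 0 else -1)%Z).
  { intros n Hn.
    destruct (reduced_poly c d m q n K k0 z eps) as [Z0 [E B]]; try lia.
    { exact Hk0. }
    { intros j Hj; apply Hz; lia. }
    fold r in E, B.
    exists Z0.
    assert (HqnN : 1 <= INR (q * n) <= INR N).
    { split; [apply (le_INR 1) | apply le_INR]; unfold N; nia. }
    destruct (Heta _ HqnN) as [He _].
    assert (EF : F 0%nat (INR (q * n)) =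
                 eta (INR (q * n)) + poly_eval r d (INR (q * n))).
    { unfold F; rewrite HD0; reflexivity. }
    assert (Hb : -1 <= F 0%nat (INR (q * n)) < 1).
    { rewrite EF; apply Rabs_le_between in He, B; lra. }
    replace (poly_eval c d (INR (q * n)) + eta (INR (q * n))) with
      (IZR (Z.of_nat m * Z0 + k0) + F 0%nat (INR (q * n))) by (rewrite E, EF; ring).
    rewrite (floorR_shift _ _ Hb); destruct Rle_dec; ring. }
  assert (Hin : forall i t, (i <= S d)%nat ->
    INR (q * 4 ^ S i) <= t <= INR (q * (2 * 4 ^ S i)) -> 1 < t < INR N).
  { intros i t Hi Ht; destruct (HK4 i Hi) as [H1 H2].
    assert (INR 1 < INR (q * 4 ^ S i)) by (apply lt_INR; nia).
    assert (INR (q * (2 * 4 ^ S i)) < INR N) by (apply lt_INR; unfold N; nia).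
    simpl (INR 1) in *; lra. }
  destruct (finite_choice 0 (fun i t =>
    INR (q * 4 ^ S i) <= t <= INR (q * (2 * 4 ^ S i)) /\ F 0%nat t = 0) (S (S d)))
    as [x Hx].
  { intros i Hi; destruct (HK4 i ltac:(lia)) as [H1 H2].
    apply root_of_sign_change.
    - apply lt_INR; nia.
    - intros t Ht; apply derivable_continuous_pt; exists (F 1%nat t).
      apply is_derive_Reals, HF; [lia | apply Hin with i; [lia | exact Ht]].
    - set (n := (4 ^ S i)%nat) in *.
      destruct (Hfloor n ltac:(lia)) as [Z1 E1].
      destruct (Hfloor (2 * n)%nat ltac:(lia)) as [Z2 E2].
      destruct (Hall (q * n)%nat ltac:(unfold N; nia)) as [w1 W1].
      destruct (Hall (q * (2 * n))%nat ltac:(unfold N; nia)) as [w2 W2].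
      rewrite E1 in W1; rewrite E2 in W2.
      assert (Hlog : Nat.odd (Nat.log2 (q * (2 * n))) =
                     negb (Nat.odd (Nat.log2 (q * n)))).
      { replace (q * (2 * n))%nat with (2 * (q * n))%nat by ring.
        rewrite Nat.log2_double, Nat.odd_succ, <- Nat.negb_odd by nia; reflexivity. }
      rewrite Hlog in W2.
      assert (Hm2 : (2 <= Z.of_nat m)%Z) by lia.
      (* If [h] had the same sign at both ends, the floors would agree modulo [m] while the
         prescribed bits differ by 1, so [m >= 2] would divide 1 or -1. *)
      destruct (Rle_dec 0 (F 0%nat (INR (q * n)))) as [L1|L1];
        destruct (Rle_dec 0 (F 0%nat (INR (q * (2 * n))))) as [L2|L2];
        try (split; intros; lra); exfalso;
        (assert (E : (Z.of_nat m * (Z1 - Z2 - w1 + w2) = 1 \/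
                      Z.of_nat m * (Z1 - Z2 - w1 + w2) = -1)%Z)
          by (destruct (Nat.odd (Nat.log2 (q * n))); simpl Z.b2z in W1, W2; lia));
        set (w := (Z1 - Z2 - w1 + w2)%Z) in E; clearbody w; clear - E Hm2;
        destruct (Z.lt_trichotomy w 0) as [Hw|[->|Hw]]; nia. }
  destruct (iterated_rolle 1 (INR N) (S d) F x HF) as [t [Ht Ht0]].
  - intros i Hi; destruct (Hx i ltac:(lia)) as [H1 H2].
    split; [apply Hin with i; assumption | exact H2].
  - intros i Hi; destruct (Hx i ltac:(lia)) as [H1 _].
    destruct (Hx (S i) ltac:(lia)) as [H2 _].
    destruct (HK4 i ltac:(lia)) as [H3 _].
    (* Each interval ends before the next begins, so the chosen roots increase strictly. *)
    assert (INR (q * (2 * 4 ^ S i)) < INR (q * 4 ^ S (S i))).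
    { apply lt_INR; rewrite (Nat.pow_succ_r' 4 (S i)); nia. }
    lra.
  - destruct (Heta t ltac:(lra)) as [_ Hne]; apply Hne.
    unfold F in Ht0; rewrite poly_eval_0 in Ht0; [lra|].
    intros j; apply (iter_deriv_coef_0 _ d); [exact Hr0 | lia].
Qed.
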